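(* Let $\mathsf P$ be a finite poset and let $(C,\pi)$ and $(C',\pi)$ be strict $\mathsf P$-graded chain complexes. Then $(C,\pi)$ and $(C',\pi)$ are isomorphic in the category $\mathbf{Ch}(\mathbf{GrVect}(\mathsf P))$ of $\mathsf P$-graded chain complexes and $\mathsf P$-filtered chain maps if and only if they are $\mathsf P$-filtered chain equivalent.
   Context: $\mathbb K$ is a field; vector spaces are finite-dimensional over $\mathbb K$. A $\mathsf P$-graded vector space $(V,\pi)$ is a vector space $V$ with idempotents $\pi=\{\pi^p\colon V\to V\}_{p\in\mathsf P}$ such that $\sum_p\pi^p=\mathrm{id}_V$ and $\pi^p\pi^q=0$ for $p\neq q$. A linear map $\phi\colon(V,\pi)\to(W,\pi)$ is $\mathsf P$-filtered if $\phi^{pq}:=\pi_W^p\circ\phi\circ\pi_V^q\neq0$ implies $p\leq q$. These form the category $\mathbf{GrVect}(\mathsf P)$. A $\mathsf P$-graded chain complex $(C,\pi)$ is a $\mathbb Z$-indexed chain complex in $\mathbf{GrVect}(\mathsf P)$: each $C_n$ is $\mathsf P$-graded and each $\partial_n\colon C_n\to C_{n-1}$ is $\mathsf P$-filtered with $\partial_{n-1}\partial_n=0$. A $\mathsf P$-filtered chain map is a chain map each of whose components is $\mathsf P$-filtered. It is strict if $\partial_n^{pp}=0$ for all $n\in\mathbb Z$, $p\in\mathsf P$. Two $\mathsf P$-filtered chain maps $\phi,\psi\colon(C,\pi)\to(C',\pi)$ are $\mathsf P$-filtered chain homotopic if there are $\mathsf P$-filtered linear maps $\gamma_n\colon C_n\to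 C'_{n+1}$ with $\phi_n-\psi_n=\gamma_{n-1}\partial_n+\partial'_{n+1}\gamma_n$ for all $n$. $(C,\pi)$ and $(C',\pi)$ are $\mathsf P$-filtered chain equivalent if there are $\mathsf P$-filtered chain maps in both directions whose two compositions are $\mathsf P$-filtered chain homotopic to the identities. *)

(* Defs.v *)
From mathcomp Require Import all_boot all_order all_algebra.

Set Implicit Arguments.
Unset Strict Implicit.
Unset Printing Implicit Defensive.

Import Order.TTheory GRing.Theory.
Local Open Scope ring_scope.

Section GradedComplexes.
Variables (K : fieldType) (d : Order.disp_t) (P : finPOrderType d).

Record grVect := GrVect {
  gr_space : vectType K;
  gr_proj : P -> 'End(gr_space);
  gr_proj_idem : forall p, (gr_proj p \o gr_proj p)%VF = gr_proj p;
  gr_proj_sum : \sum_(p : P) gr_proj p = \1%VF;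
  gr_proj_ortho : forall p q, p != q -> (gr_proj p \o gr_proj q)%VF = 0
}.
Coercion gr_space : grVect >-> Vector.type.

Definition gr_component (V W : grVect) (phi : 'Hom(V, W)) (p q : P) : 'Hom(V, W) :=
  (gr_proj W p \o phi \o gr_proj V q)%VF.

Definition filtered (V W : grVect) (phi : 'Hom(V, W)) : Prop :=
  forall p q, gr_component phi p q != 0 -> (p <= q)%O.

Lemma filtered_id (V : grVect) : filtered (\1%VF : 'Hom(V, V)).
Proof.
move=> p q; rewrite /gr_component comp_lfun1r.
by have [-> // | /gr_proj_ortho->] := eqVneq p q; rewrite eqxx.
Qed.

Lemma filtered_comp (U V W : grVect) (psi : 'Hom(V, W)) (phi : 'Hom(U, V)) :
  filtered psi -> filtered phi -> filtered (psi \o phi)%VF.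
Proof.
move=> psiF phiF p q; apply: contraNT => npq; apply/eqP.
have -> : gr_component (psi \o phi)%VF p q =
    \sum_r (gr_component psi p r \o gr_component phi r q)%VF.
  apply/lfunP=> v; rewrite sum_lfunE /gr_component !comp_lfunE.
  under eq_bigr => r _.
    rewrite !comp_lfunE -[gr_proj V r (gr_proj V r _)]comp_lfunE gr_proj_idem.
    over.
  by rewrite -!linear_sum -sum_lfunE gr_proj_sum id_lfunE.
apply: big1 => r _.
have [-> | /psiF pr] := eqVneq (gr_component psi p r) 0; first exact: comp_lfun0l.
have [-> | /phiF rq] := eqVneq (gr_component phi r q) 0; first exact: comp_lfun0r.
by rewrite (le_trans pr rq) in npq.
Qed.

(* The differential is indexed by its target: [bd C n] is the boundary map     *)
(* usually written with index n + 1, from C_(n+1) to C_n.  As n ranges over    *)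
(* all integers this covers every boundary map, and no transport along         *)
(* (n - 1) + 1 = n is needed in the homotopy relation below.                   *)
Record grComplex := GrComplex {
  cx_obj : int -> grVect;
  bd : forall n : int, 'Hom(cx_obj (n + 1), cx_obj n);
  bd_filtered : forall n, filtered (bd n);
  bd_bd : forall n, (bd n \o bd (n + 1))%VF = 0
}.
Coercion cx_obj : grComplex >-> Funclass.

Definition strict (C : grComplex) : Prop :=
  forall (n : int) (p : P), gr_component (bd C n) p p = 0.

Record chainMap (C C' : grComplex) := ChainMap {
  cm_fun : forall n : int, 'Hom(C n, C' n);
  cm_filtered : forall n, filtered (cm_fun n);
  cm_bd : forall n, (cm_fun n \o bd C n)%VF = (bd C' n \o cm_fun (n + 1))%VF
}.
Coercion cm_fun : chainMap >-> Funclass.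

Lemma chain_id_bd (C : grComplex) (n : int) :
  (\1 \o bd C n)%VF = (bd C n \o \1)%VF.
Proof. by rewrite comp_lfun1l comp_lfun1r. Qed.

Definition chain_id (C : grComplex) : chainMap C C :=
  ChainMap (fun n => @filtered_id (C n)) (@chain_id_bd C).

Lemma chain_comp_bd (C C' C'' : grComplex)
    (psi : chainMap C' C'') (phi : chainMap C C') (n : int) :
  (psi n \o phi n \o bd C n)%VF
    = (bd C'' n \o (psi (n + 1)%R \o phi (n + 1)%R))%VF.
Proof. by rewrite -comp_lfunA cm_bd comp_lfunA cm_bd comp_lfunA. Qed.

Definition chain_comp (C C' C'' : grComplex)
    (psi : chainMap C' C'') (phi : chainMap C C') : chainMap C C'' :=
  ChainMap (fun n => filtered_comp (@cm_filtered _ _ psi n) (@cm_filtered _ _ phi n))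
           (chain_comp_bd psi phi).

(* Equality of morphisms of complexes: the proof components are ignored.       *)
Definition chain_eq (C C' : grComplex) (phi psi : chainMap C C') : Prop :=
  forall n : int, phi n = psi n.

Definition chain_isomorphic (C C' : grComplex) : Prop :=
  exists (phi : chainMap C C') (psi : chainMap C' C),
    chain_eq (chain_comp psi phi) (chain_id C) /\
    chain_eq (chain_comp phi psi) (chain_id C').

(* The relation is stated in degree n + 1, which is an arbitrary integer.      *)
Definition chain_homotopic (C C' : grComplex) (phi psi : chainMap C C') : Prop :=
  exists gamma : forall n : int, 'Hom(C n, C' (n + 1)),
    (forall n, filtered (gamma n)) /\
    (forall n, phi (n + 1) - psi (n + 1) =
       (gamma n \o bd C n)%VF + (bd C' (n + 1) \o gamma (n + 1)%R)%VF).

Definition chain_equivalent (C C' : grComplex) : Prop :=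
  exists (phi : chainMap C C') (psi : chainMap C' C),
    chain_homotopic (chain_comp psi phi) (chain_id C) /\
    chain_homotopic (chain_comp phi psi) (chain_id C').

End GradedComplexes.

(* Main.v *)
Require Import Defs.
From mathcomp Require Import all_boot all_order all_algebra.

(** An isomorphism is a homotopy equivalence with zero homotopies.  For the
    converse, let [phi] and [psi] be mutually inverse up to filtered homotopy.
    Since the differentials are strict, they strictly lower the grading, and so
    does every [gamma d + d gamma]: in each degree [psi phi - 1] and
    [phi psi - 1] are strictly upper triangular with respect to the order of
    the poset.  An endomorphism that is the identity plus a strictly triangular
    part is invertible with triangular inverse ([unitriangular_inj],
    [unitriangular_inv_filtered]).  Hence [phi] is bijective in each degree,
    and [(psi phi)^-1 psi] is its inverse, which is again filtered and commutes
    with the differentials.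

    Both facts about unitriangular maps follow, without expanding the geometric
    series of a nilpotent map, by induction on the grade from the top of the
    poset downwards: in [f = 1 + N], the part of [N] landing in grade [p] only
    sees grades strictly above [p]. *)

Import Order.TTheory GRing.Theory.
Local Open Scope ring_scope.

Lemma poset_ind_down (d : Order.disp_t) (P : finPOrderType d) (Q : P -> Prop) :
  (forall p, (forall r, (p < r)%O -> Q r) -> Q p) -> forall p, Q p.
Proof.
move=> IH p; have [m] := ubnP #|[pred r | (p < r)%O]|.
elim: m p => // m IHm p; rewrite ltnS => le_m.
apply: IH => r lt_pr; apply: IHm; apply: leq_trans le_m.
apply: proper_card; apply/properP; split.
  by apply/subsetP => s; rewrite !inE; apply: lt_trans.
by exists r; rewrite !inE ?ltxx.
Qed.

(** The homotopy relation speaks of degrees of the form [n + 1] only. *)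
Lemma int_all_succ (Q : int -> Prop) :
  (forall n, Q (n + 1)) -> forall n, Q n.
Proof. by move=> QS n; rewrite -[n](subrK 1). Qed.

Section Triangular.
Context {K : fieldType} {d : Order.disp_t} {P : finPOrderType d}.
Implicit Types U V W : grVect K P.

Lemma gr_component_comp {U V W} (psi : 'Hom(V, W)) (phi : 'Hom(U, V)) p q :
  gr_component (psi \o phi)%VF p q =
    \sum_r (gr_component psi p r \o gr_component phi r q)%VF.
Proof.
apply/lfunP=> v; rewrite sum_lfunE /gr_component !comp_lfunE.
under eq_bigr => r _.
  rewrite !comp_lfunE -[gr_proj V r (gr_proj V r _)]comp_lfunE gr_proj_idem.
  over.
by rewrite -!linear_sum -sum_lfunE gr_proj_sum id_lfunE.
Qed.

Lemma gr_componentD {V W} (f g : 'Hom(V, W)) p q :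
  gr_component (f + g) p q = gr_component f p q + gr_component g p q.
Proof. by rewrite /gr_component comp_lfunDr comp_lfunDl. Qed.

Lemma gr_componentB {V W} (f g : 'Hom(V, W)) p q :
  gr_component (f - g) p q = gr_component f p q - gr_component g p q.
Proof. by rewrite gr_componentD /gr_component comp_lfunNr comp_lfunNl. Qed.

Lemma gr_proj_sumE {V} (v : V) : \sum_p gr_proj V p v = v.
Proof. by rewrite -sum_lfunE gr_proj_sum id_lfunE. Qed.

Lemma gr_proj_sum_component {V W} (f : 'Hom(V, W)) p v :
  gr_proj W p (f v) = \sum_q gr_component f p q v.
Proof.
rewrite -[in LHS](gr_proj_sumE v) !linear_sum.
by apply: eq_bigr => q _; rewrite /gr_component !comp_lfunE.
Qed.

Lemma filtered0 {V W} : filtered (0 : 'Hom(V, W)).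
Proof. by move=> p q; rewrite /gr_component comp_lfun0r comp_lfun0l eqxx. Qed.

Definition strictly_filtered {V W} (f : 'Hom(V, W)) : Prop :=
  forall p q, gr_component f p q != 0 -> (p < q)%O.

Lemma filtered_strictly {V W} (f : 'Hom(V, W)) :
  filtered f -> (forall p, gr_component f p p = 0) -> strictly_filtered f.
Proof.
move=> fF f0 p q nz; rewrite lt_neqAle (fF _ _ nz) andbT.
by apply: contraNneq nz => ->; rewrite f0.
Qed.

Lemma strictly_filteredD {V W} (f g : 'Hom(V, W)) :
  strictly_filtered f -> strictly_filtered g -> strictly_filtered (f + g).
Proof.
move=> fS gS p q; rewrite gr_componentD.
have [->|/fS //] := eqVneq (gr_component f p q) 0.
by rewrite add0r => /gS.
Qed.

Lemma strictly_filtered_compl {U V W} (psi : 'Hom(V, W)) (phi : 'Hom(U, V)) :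
  strictly_filtered psi -> filtered phi -> strictly_filtered (psi \o phi)%VF.
Proof.
move=> psiS phiF p q; apply: contraNT => npq; apply/eqP.
rewrite gr_component_comp; apply: big1 => r _.
have [-> | /psiS pr] := eqVneq (gr_component psi p r) 0; first exact: comp_lfun0l.
have [-> | /phiF rq] := eqVneq (gr_component phi r q) 0; first exact: comp_lfun0r.
by rewrite (lt_le_trans pr rq) in npq.
Qed.

Lemma strictly_filtered_compr {U V W} (psi : 'Hom(V, W)) (phi : 'Hom(U, V)) :
  filtered psi -> strictly_filtered phi -> strictly_filtered (psi \o phi)%VF.
Proof.
move=> psiF phiS p q; apply: contraNT => npq; apply/eqP.
rewrite gr_component_comp; apply: big1 => r _.
have [-> | /psiF pr] := eqVneq (gr_component psi p r) 0; first exact: comp_lfun0l.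
have [-> | /phiS rq] := eqVneq (gr_component phi r q) 0; first exact: comp_lfun0r.
by rewrite (le_lt_trans pr rq) in npq.
Qed.

(** If [f = 1 + N] kills [v] then [v = - N v], so the part of [v] in grade [p]
    is determined by its parts in the grades above [p]. *)
Lemma unitriangular_inj {V} (f : 'End(V)) :
  strictly_filtered (f - \1%VF) -> lker f == 0%VS.
Proof.
move=> fS; rewrite -subv0; apply/subvP => v; rewrite memv_ker memv0.
move=> /eqP fv0; apply/eqP.
have vE : v = - (f - \1%VF) v.
  by rewrite add_lfunE opp_lfunE id_lfunE fv0 sub0r opprK.
rewrite -(gr_proj_sumE v); apply: big1 => p _.
elim/poset_ind_down: p => p IH.
rewrite vE linearN /= gr_proj_sum_component big1 ?oppr0 // => q _.
have [-> | /fS pq] := eqVneq (gr_component (f - \1%VF) p q) 0.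
  by rewrite lfunE.
by rewrite /gr_component comp_lfunE (IH _ pq) linear0.
Qed.

(** The inverse [g] of [f = 1 + N] satisfies [g = 1 - N g]; a nonzero component
    of [g] from [q] to [p] thus comes from [p = q], or from a nonzero component
    of [g] from [q] to some grade above [p]. *)
Lemma unitriangular_inv_filtered {V} (f : 'End(V)) :
  strictly_filtered (f - \1%VF) -> filtered (f^-1)%VF.
Proof.
move=> fS p q; elim/poset_ind_down: p => p IH.
have gE : (f^-1 = \1 - ((f - \1) \o f^-1))%VF.
  rewrite comp_lfunDl comp_lfunNl comp_lfun1l.
  by rewrite (lker0_compfV (unitriangular_inj f fS)) subKr.
rewrite gE gr_componentB.
have [-> | /filtered_id //] := eqVneq (gr_component (\1%VF : 'End(V)) p q) 0.
rewrite sub0r oppr_eq0 => nz; apply: contraNT nz => npq; apply/eqP.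
rewrite gr_component_comp big1 // => r _.
have [-> | /fS pr] := eqVneq (gr_component (f - \1%VF) p r) 0.
  exact: comp_lfun0l.
have [-> | /(IH _ pr) rq] := eqVneq (gr_component (f^-1)%VF r q) 0.
  exact: comp_lfun0r.
by rewrite (le_trans (ltW pr) rq) in npq.
Qed.

Lemma lker0_compr {U V W} (psi : 'Hom(V, W)) (phi : 'Hom(U, V)) :
  lker (psi \o phi)%VF == 0%VS -> lker phi == 0%VS.
Proof.
move=> /lker0P inj; apply/lker0P => u v uv.
by apply: inj; rewrite !comp_lfunE uv.
Qed.

Lemma lker0_comp_inj {U V W} (f : 'Hom(V, W)) (g h : 'Hom(U, V)) :
  lker f == 0%VS -> (f \o g = f \o h)%VF -> g = h.
Proof.
move=> /lker0P inj fgh; apply/lfunP => u; apply: inj.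
by rewrite -!comp_lfunE fgh.
Qed.

Lemma strict_bd (C : grComplex K P) :
  strict C -> forall n, strictly_filtered (bd C n).
Proof.
by move=> hC n; apply: filtered_strictly (hC n); apply: bd_filtered.
Qed.

(** Between strict complexes a null-homotopic map strictly lowers the grading,
    since both terms of [gamma d + d gamma] contain a differential. *)
Lemma homotopic_strictly_filtered {C C' : grComplex K P}
    (f g : chainMap C C') :
  strict C -> strict C' -> chain_homotopic f g ->
  forall n, strictly_filtered (f n - g n).
Proof.
move=> /strict_bd hC /strict_bd hC' [gamma [gF gE]]; apply: int_all_succ => n.
rewrite gE; apply: strictly_filteredD.
  exact: strictly_filtered_compr.
exact: strictly_filtered_compl.
Qed.

Lemma chain_homotopic_eq {C C' : grComplex K P} (f g : chainMap C C') :
  chain_eq f g -> chain_homotopic f g.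
Proof.
move=> fg; exists (fun n => 0); split=> [n|n]; first exact: filtered0.
by rewrite fg subrr comp_lfun0l comp_lfun0r addr0.
Qed.

(** Commutation with the differentials is inherited by a degreewise inverse. *)
Lemma chain_isomorphic_inverse {C C' : grComplex K P} (phi : chainMap C C')
    (g : forall n, 'Hom(C' n, C n)) :
  (forall n, filtered (g n)) ->
  (forall n, (g n \o phi n = \1)%VF) -> (forall n, (phi n \o g n = \1)%VF) ->
  chain_isomorphic C C'.
Proof.
move=> gF gphi phig.
have gbd n : (g n \o bd C' n = bd C n \o g (n + 1)%R)%VF.
  rewrite -[bd C' n in LHS]comp_lfun1r -phig (comp_lfunA (bd C' n)) -cm_bd.
  by rewrite !comp_lfunA gphi comp_lfun1l.
by exists phi, (ChainMap gF gbd); split=> n /=.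
Qed.

End Triangular.

Theorem proposition4p27 (K : fieldType) (d : Order.disp_t) (P : finPOrderType d)
    (C C' : grComplex K P) (hC : strict C) (hC' : strict C') :
  chain_isomorphic C C' <-> chain_equivalent C C'.
Proof.
split=> [[phi [psi [e1 e2]]] | [phi [psi [h1 h2]]]].
  by exists phi, psi; split; apply: chain_homotopic_eq.
have S1 := homotopic_strictly_filtered _ _ hC hC h1.
have S2 := homotopic_strictly_filtered _ _ hC' hC' h2.
have psiphi_inj n := unitriangular_inj _ (S1 n).
have psi_inj n : lker (psi n) == 0%VS.
  exact: lker0_compr (unitriangular_inj _ (S2 n)).
apply: (chain_isomorphic_inverse phi
  (fun n => ((psi n \o phi n)^-1 \o psi n)%VF)) => n.
- apply: filtered_comp; last exact: cm_filtered.
  exact: unitriangular_inv_filtered (S1 n).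
- by rewrite -comp_lfunA lker0_compVf.
(* Left multiplication by the injective [psi n] turns this into the fact that
   [(psi phi)^-1] is also a right inverse of [psi phi]. *)
- apply: (lker0_comp_inj _ _ _ (psi_inj n)).
  by rewrite !comp_lfunA lker0_compfV // comp_lfun1l comp_lfun1r.
Qed.
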